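(* The following hold in $\Lambda^4\mathbb{R}^8$, where $\mathbb{R}^8\cong\mathbb{H}^2\cong\mathbb{O}$. (1) The right quaternionic 4-form $\Omega_R$ can be obtained from the Kähler forms $\phi_i,\phi_j,\dots,\phi_h$ of the complex structures $R_i,R_j,\dots,R_h$ on $\mathbb{O}$ as $$\Omega_R=\phi_i^2+\phi_j^2+\phi_k^2-\phi_e^2-\phi_f^2-\phi_g^2-\phi_h^2 .$$ (2) Select any five of the seven complex structures $R_i,R_j,R_k,R_e,R_f,R_g,R_h$ on $\mathbb{O}$, call them $J_1,\dots,J_5$, and for $1\le\alpha<\beta\le5$ let $\zeta_{\alpha\beta}$ be the Kähler 2-form of $J_{\alpha\beta}=J_\alpha\circ J_\beta$. Then, up to a permutation and changes of signs of some coordinates in $\mathbb{R}^8$ (i.e. up to pull-back by a linear map of $\mathbb{R}^8$ that permutes the standard basis vectors up to signs), the left quaternionic 4-form is $$\Omega_L=-\frac12\sum_{1\le\alpha<\beta\le5}\zeta_{\alpha\beta}^2 .$$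
   Context: Octonion multiplication is defined from the quaternions $\mathbb{H}$ by Cayley–Dickson: for $x=h_1+h_2e$, $x'=h_1'+h_2'e$ with $h_1,h_2,h_1',h_2'\in\mathbb{H}$, $xx'=(h_1h_1'-\bar h_2'h_2)+(h_2\bar h_1'+h_2'h_1)e$. The standard basis of $\mathbb{O}$ is $1,i,j,k,e,f=ie,g=je,h=ke$. One identifies $\mathbb{R}^8\cong\mathbb{H}^2\cong\mathbb{O}$ by $(h_1,h_2)\leftrightarrow h_1+h_2e$, with the standard inner product $\langle\cdot,\cdot\rangle$; the coordinates $1,\dots,8$ are those in the basis $1,i,j,k,e,f,g,h$. For an orthogonal complex structure $J$ on $\mathbb{R}^8$, its Kähler 2-form is $\omega_J(x,y)=\langle x,Jy\rangle$. For a 2-form $\omega$, $\omega^2=\omega\wedge\omega$. For $u\in\{i,j,k,e,f,g,h\}$, $R_u:\mathbb{O}\to\mathbb{O}$ denotes octonionic right multiplication $R_u(x)=xu$, an orthogonal complex structure, and $\phi_u$ is its Kähler 2-form. On $\mathbb{H}^2$, for $u\in\{i,j,k\}$ let $\omega_{R_u}$ and $\omega_{L_u}$ denote the Kähler 2-forms of the quaternionic multiplications $(h_1,h_2)\mapsto(h_1u,h_2u)$ and $(h_1,h_2)\mapsto(uh_1,uh_2)$ respectively. The right and left quaternionic 4-forms are $$\Omega_R=\omega_{R_i}^2+\omega_{R_j}^2+\omega_{R_k}^2,\qquad \Omega_L=\omega_{L_i}^2+\omega_{L_j}^2+\omega_{L_k}^2 .$$ *)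

(* Defs.v *)
From mathcomp Require Import all_boot all_order all_algebra all_fingroup.
From mathcomp Require Import reals.

Set Implicit Arguments.
Unset Strict Implicit.
Unset Printing Implicit Defensive.

Import GRing.Theory Num.Theory.
Local Open Scope ring_scope.

Notation quat R := 'rV[R]_4.

Definition mkquat (R : realType) (a b c d : R) : quat R :=
  \row_(n < 4) [:: a; b; c; d]`_n.

Definition q1 (R : realType) : quat R := mkquat 1 0 0 0.
Definition qi (R : realType) : quat R := mkquat 0 1 0 0.
Definition qj (R : realType) : quat R := mkquat 0 0 1 0.
Definition qk (R : realType) : quat R := mkquat 0 0 0 1.

Definition qcoord (R : realType) (p : quat R) (n : nat) : R := p 0 (inord n).

Definition qmul (R : realType) (p q : quat R) : quat R :=
  let: (a, b, c, d) := (qcoord p 0, qcoord p 1, qcoord p 2, qcoord p 3) in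
  let: (a', b', c', d') := (qcoord q 0, qcoord q 1, qcoord q 2, qcoord q 3) in
  mkquat (a * a' - b * b' - c * c' - d * d')
         (a * b' + b * a' + c * d' - d * c')
         (a * c' - b * d' + c * a' + d * b')
         (a * d' + b * c' - c * b' + d * a').

Definition qconj (R : realType) (p : quat R) : quat R :=
  mkquat (qcoord p 0) (- qcoord p 1) (- qcoord p 2) (- qcoord p 3).

(* R^8, H^2 and O share one carrier: the row vector with left half h1 and
   right half h2 stands for (h1, h2) and for h1 + h2 e. *)
Notation oct R := 'rV[R]_8.

Definition mkoct (R : realType) (h1 h2 : quat R) : oct R := row_mx h1 h2.
Definition oct1 (R : realType) (x : oct R) : quat R := @lsubmx R 1 4 4 x.
Definition oct2 (R : realType) (x : oct R) : quat R := @rsubmx R 1 4 4 x.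

Definition omul (R : realType) (x x' : oct R) : oct R :=
  mkoct (qmul (oct1 x) (oct1 x') - qmul (qconj (oct2 x')) (oct2 x))
        (qmul (oct2 x) (qconj (oct1 x')) + qmul (oct2 x') (oct1 x)).

Definition oi (R : realType) : oct R := mkoct (qi R) 0.
Definition oj (R : realType) : oct R := mkoct (qj R) 0.
Definition ok (R : realType) : oct R := mkoct (qk R) 0.
Definition oe (R : realType) : oct R := mkoct 0 (q1 R).
Definition of_ (R : realType) : oct R := omul (oi R) (oe R).
Definition og (R : realType) : oct R := omul (oj R) (oe R).
Definition oh (R : realType) : oct R := omul (ok R) (oe R).

Definition imag_units (R : realType) : seq (oct R) :=
  [:: oi R; oj R; ok R; oe R; of_ R; og R; oh R].

Definition oct_right (R : realType) (u x : oct R) : oct R := omul x u.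

Definition quat_right (R : realType) (u : quat R) (x : oct R) : oct R :=
  mkoct (qmul (oct1 x) u) (qmul (oct2 x) u).
Definition quat_left (R : realType) (u : quat R) (x : oct R) : oct R :=
  mkoct (qmul u (oct1 x)) (qmul u (oct2 x)).

Definition inner (R : realType) (x y : oct R) : R :=
  \sum_(n < 8) x 0 n * y 0 n.

(* A k-form is given by its values on k-tuples of vectors; multilinearity and
   alternation are not part of the type, so an identity in Lambda^k(R^8) is
   stated as equality of the two sides on all k-tuples. *)
Definition form (R : realType) (k : nat) := ('I_k -> oct R) -> R.

Definition kahler (R : realType) (J : oct R -> oct R) : form R 2 :=
  fun v => inner (v ord0) (J (v ord_max)).

(* Normalised so that (a /\ b)(x, y) = a x * b y - a y * b x for 1-forms. *)
Definition wedge (R : realType) (p q : nat) (a : form R p) (b : form R q) :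
    form R (p + q) :=
  fun v => (p`! * q`!)%:R^-1 *
    \sum_(s : 'S_(p + q)) (-1) ^+ s *
      (a (fun n => v (s (lshift q n))) * b (fun n => v (s (rshift p n)))).

Definition wedge_sq (R : realType) (w : form R 2) : form R 4 := wedge w w.

Definition phi (R : realType) (u : oct R) : form R 2 := kahler (oct_right u).

Definition Omega_R (R : realType) : form R 4 := fun v =>
  wedge_sq (kahler (quat_right (qi R))) v +
  wedge_sq (kahler (quat_right (qj R))) v +
  wedge_sq (kahler (quat_right (qk R))) v.

Definition Omega_L (R : realType) : form R 4 := fun v =>
  wedge_sq (kahler (quat_left (qi R))) v +
  wedge_sq (kahler (quat_left (qj R))) v +
  wedge_sq (kahler (quat_left (qk R))) v.

(* Vectors are rows, so the linear map with matrix A is x |-> x *m A. *)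
Definition pullback (R : realType) (k : nat) (A : 'M[R]_8) (w : form R k) :
    form R k :=
  fun v => w (fun n => v n *m A).

Definition signed_perm_mx (R : realType) (A : 'M[R]_8) : Prop :=
  exists (s : 'S_8) (eps : 'I_8 -> bool),
    forall n : 'I_8, delta_mx 0 n *m A = (-1) ^+ eps n *: delta_mx 0 (s n) :> oct R.

Definition zeta (R : realType) (u : 5.-tuple (oct R)) (a b : 'I_5) : form R 2 :=
  kahler (oct_right (tnth u a) \o oct_right (tnth u b)).

Definition zeta_sq_sum (R : realType) (u : 5.-tuple (oct R)) : form R 4 :=
  fun v => \sum_(a < 5) \sum_(b < 5 | (a < b)%N) wedge_sq (zeta u a b) v.

(* Main.v *)
From HB Require Import structures.
Require Import Defs.
From mathcomp Require Import all_boot all_order all_algebra all_fingroup.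
From mathcomp Require Import reals ring.

Set Implicit Arguments.
Unset Strict Implicit.
Unset Printing Implicit Defensive.

Import GRing.Theory Num.Theory.
Local Open Scope ring_scope.

(** Write R_a for right multiplication by the basis unit of index a, Q_a for
the square of its Kaehler form, Q_ab for the square of the Kaehler form of
R_a o R_b, and S for the sum of the seven Q_a.  Both parts follow from a single
relation ([right2_sq_key]):

    Q_ab = Q_a + Q_b - S/3    for distinct imaginary units a, b.

Such a relation has to exist by symmetry.  The map sending a /\ b to the
Kaehler form of R_a o R_b identifies Lambda^2 R^7 with so(7), so squaring gives
a Spin(7)-equivariant map from S^2(Lambda^2 R^7) to Lambda^4 R^8, which only
sees the trivial summand, the traceless part of S^2 R^7, and Lambda^4 R^7.
The Lambda^4 R^7 part of (a /\ b)^2 vanishes, and what is left of it is a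
combination of a^2 + b^2 and of the invariant.  The coefficients are those
found by a finite computation: in the basis the 4-forms have integer
coefficients, and [right2_coefE] compares them.

Part (1).  Right multiplication by a quaternion unit u on H^2 is, up to sign,
R_a o R_b where a and b are the other two quaternion units
([quat_right_sq]).  Hence Omega_R = Q_ij + Q_jk + Q_ki
= 2 (Q_i + Q_j + Q_k) - S, which is the assertion.

Part (2).  Let a, b be the two units outside of the five selected ones.
Summing the relation over the ten pairs gives
4 (S - Q_a - Q_b) - 10 S/3 = - 2 (Q_a + Q_b + Q_ab) ([zeta_sq_sumE]).  Now R_a,
R_b and R_a o R_b satisfy the relations of L_i, L_j and L_k, so the
linear map that sends 1, i, j, k, e, ie, je, ke to the vectors obtained from 1
and from a fourth basis vector c by applying id, R_a, R_b, R_a o R_b intertwines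
the two triples.  Products of basis vectors being basis vectors up to sign, this
map is a signed permutation, hence isometric, and it pulls Q_a, Q_b and Q_ab
back to the three squares of Omega_L ([frame_kahler]).

The standard basis is numbered so that the product of the basis vectors m and n
is, up to sign, the basis vector [Nat.lxor m n]; all the operators involved are
thus translations of F_2^3 decorated with signs. *)

(** * Squares of Kaehler forms *)

(** [lift_perm] decomposes a permutation into the image of [ord0] and the
permutation that it induces on the remaining points. *)
Lemma sum_lift_perm (V : nmodType) n (F : 'S_n.+1 -> V) :
  \sum_(s : 'S_n.+1) F s = \sum_(i < n.+1) \sum_(s : 'S_n) F (lift_perm ord0 i s).
Proof.
(* Injectivity is enough, as both sides have (n+1)! elements. *)
pose f (x : 'I_n.+1 * 'S_n) := lift_perm ord0 x.1 x.2.
have f_inj : injective f.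
  move=> [i s] [j t] /permP eq_f.
  have eq_ij : i = j by have := eq_f ord0; rewrite !lift_perm_id.
  rewrite -{}eq_ij in eq_f *; congr (_, _); apply/permP => k.
  by have := eq_f (lift ord0 k); rewrite !lift_perm_lift; apply: lift_inj.
rewrite pair_big /= (reindex f) //; apply/onW_bij/inj_card_bij => //.
by rewrite card_prod card_ord !card_Sn factS.
Qed.

Lemma sum_S4 (V : nmodType) (F : 'S_4 -> V) :
  \sum_(s : 'S_4) F s = \sum_(i < 4) \sum_(j < 3) \sum_(k < 2)
    F (lift_perm ord0 i (lift_perm ord0 j (lift_perm ord0 k 1%g))).
Proof.
rewrite sum_lift_perm; apply: eq_bigr => i _.
rewrite sum_lift_perm; apply: eq_bigr => j _.
rewrite sum_lift_perm; apply: eq_bigr => k _.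
apply: big_pred1 => s; apply/esym/eqP/permP => x.
by rewrite (ord1 x) (ord1 (s _)) (ord1 (_ ord0)).
Qed.

(** For a skew operator the 24 terms of the shuffle sum come in three groups of
eight equal ones, one for each way to pair off four vectors; the normalisation
leaves the factor 2. *)
Lemma wedge_sq_kahler (R : realType) (J : oct R -> oct R) (v : 'I_4 -> oct R) :
    (forall x y, inner y (J x) = - inner x (J y)) ->
  let w i j := inner (v (inord i)) (J (v (inord j))) in
  wedge_sq (kahler J) v =
    2 * (w 0%N 1%N * w 2%N 3%N - w 0%N 2%N * w 1%N 3%N + w 0%N 3%N * w 1%N 2%N).
Proof.
move=> skewJ w.
have wN i j : w j i = - w i j by apply: skewJ.
have L0 : lshift 2 (ord0 : 'I_2) = (ord0 : 'I_4) by apply: val_inj.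
have L1 : lshift 2 (ord_max : 'I_2) = (lift ord0 ord0 : 'I_4) by apply: val_inj.
have L2 : rshift 2 (ord0 : 'I_2) = (lift ord0 (lift ord0 ord0) : 'I_4) by apply: val_inj.
have L3 : rshift 2 (ord_max : 'I_2) = (lift ord0 (lift ord0 (lift ord0 ord0)) : 'I_4)
  by apply: val_inj.
rewrite /wedge_sq /wedge sum_S4 /kahler L0 L1 L2 L3.
under eq_bigr => i _ do under eq_bigr => j _ do under eq_bigr => k _ do
  rewrite !odd_lift_perm odd_perm1 !(lift_perm_id, lift_perm_lift) perm1.
have wE (i j : 'I_4) : inner (v i) (J (v j)) = w i j by rewrite /w !inord_val.
under eq_bigr => i _ do under eq_bigr => j _ do under eq_bigr => k _ do
  rewrite !wE.
clearbody w; rewrite !big_ord_recl !big_ord0 /= /bump /=.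
rewrite !addr0 !add0n !addn0 /= (wN 0%N) (wN 0 2)%N (wN 0 3)%N.
rewrite (wN 1 2)%N (wN 1 3)%N (wN 2 3)%N.
change (1 + 1)%N with 2%N; change (1 + 2)%N with 3%N.
by rewrite (_ : (2`! * 2`!)%N = 4%N) // !expr0 !expr1; field.
Qed.

(** * Forms with integer coefficients *)

Definition form2 (R : realType) (W : nat -> nat -> int) (x y : oct R) : R :=
  \sum_(p < 8) \sum_(q < 8) x 0 p * y 0 q * (W p q)%:~R.

Definition form4 (R : realType) (C : nat -> nat -> nat -> nat -> int)
    (v : 'I_4 -> oct R) : R :=
  \sum_(p < 8) \sum_(q < 8) \sum_(r < 8) \sum_(s < 8)
    v (inord 0) 0 p * v (inord 1) 0 q * v (inord 2) 0 r * v (inord 3) 0 s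
    * (C p q r s)%:~R.

(** Half of the coefficients of the square of the 2-form with matrix [W]. *)
Definition sq_coef (W : nat -> nat -> int) (p q r s : nat) : int :=
  W p q * W r s - W p r * W q s + W p s * W q r.

Lemma form2M (R : realType) W (x y z t : oct R) :
  form2 W x y * form2 W z t =
    \sum_(p < 8) \sum_(q < 8) \sum_(r < 8) \sum_(s < 8)
      (x 0 p * y 0 q * (W p q)%:~R) * (z 0 r * t 0 s * (W r s)%:~R).
Proof.
rewrite /form2 big_distrl; apply: eq_bigr => p _.
rewrite big_distrl; apply: eq_bigr => q _.
rewrite big_distrr; apply: eq_bigr => r _.
by rewrite big_distrr.
Qed.

(** This reduces linear relations between squares to identities between
integers. *)
Lemma wedge_sq_form2 (R : realType) (J : oct R -> oct R) W v :
    (forall x y, inner x (J y) = form2 W x y) ->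
    (forall p q : 'I_8, W q p = - W p q) ->
  wedge_sq (kahler J) v = 2 * form4 (sq_coef W) v.
Proof.
move=> JW WN; rewrite wedge_sq_kahler => [|x y]; last first.
  rewrite !JW /form2 exchange_big -sumrN; apply: eq_bigr => p _ /=.
  rewrite -sumrN; apply: eq_bigr => q _.
  by rewrite WN rmorphN mulrN [y 0 q * _]mulrC.
congr (_ * _); rewrite !JW.
set x := v _; set y := v _; set z := v _; set t := v _.
have -> : form2 W x z * form2 W y t =
    \sum_(p < 8) \sum_(q < 8) \sum_(r < 8) \sum_(s < 8)
      (x 0 p * z 0 r * (W p r)%:~R) * (y 0 q * t 0 s * (W q s)%:~R).
  by rewrite form2M; apply: eq_bigr => p _; rewrite exchange_big.
have -> : form2 W x t * form2 W y z =
    \sum_(p < 8) \sum_(q < 8) \sum_(r < 8) \sum_(s < 8)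
      (x 0 p * t 0 s * (W p s)%:~R) * (y 0 q * z 0 r * (W q r)%:~R).
  rewrite form2M; apply: eq_bigr => p _; rewrite exchange_big.
  by apply: eq_bigr => q _; rewrite exchange_big.
rewrite form2M /form4 -/x -/y -/z -/t.
rewrite -sumrB -big_split; apply: eq_bigr => p _ /=.
rewrite -sumrB -big_split; apply: eq_bigr => q _ /=.
rewrite -sumrB -big_split; apply: eq_bigr => r _ /=.
rewrite -sumrB -big_split; apply: eq_bigr => s _ /=.
by rewrite /sq_coef rmorphD rmorphB !rmorphM /=; ring.
Qed.

Lemma form4_ext (R : realType) (C C' : nat -> nat -> nat -> nat -> int)
    (v : 'I_4 -> oct R) :
    (forall p q r s : 'I_8, C p q r s = C' p q r s) ->
  form4 C v = form4 C' v.
Proof.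
move=> eqC; rewrite /form4.
by do 4!(apply: eq_bigr => ? _); rewrite eqC.
Qed.

Lemma form4D (R : realType) C C' (v : 'I_4 -> oct R) :
  form4 (fun p q r s => C p q r s + C' p q r s) v = form4 C v + form4 C' v.
Proof.
rewrite /form4; do 4!(rewrite -big_split; apply: eq_bigr => ? _ /=).
by rewrite rmorphD mulrDr.
Qed.

Lemma form4Z (R : realType) z C (v : 'I_4 -> oct R) :
  form4 (fun p q r s => z * C p q r s) v = z%:~R * form4 C v.
Proof.
rewrite /form4; do 4!(rewrite big_distrr; apply: eq_bigr => ? _).
by rewrite rmorphM /= mulrCA.
Qed.

Lemma form4_sum (R : realType) (I : Type) (l : seq I) C (v : 'I_4 -> oct R) :
  \sum_(i <- l) form4 (C i) v =
    form4 (fun p q r s => foldr (fun i z => C i p q r s + z) 0 l) v.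
Proof.
elim: l => [|i l IHl]; last by rewrite big_cons IHl -form4D.
by rewrite big_nil /form4; do 4!(rewrite big1 // => ? _); rewrite mulr0.
Qed.

(** * The octonion multiplication table *)

Definition qbasis (R : realType) (m : nat) : quat R := delta_mx 0 (inord m).
Definition obasis (R : realType) (m : nat) : oct R := delta_mx 0 (inord m).

(** The sign bit of the product of two quaternion basis elements: row and column
are ordered as 1, i, j, k. *)
Definition qsign (m n : nat) : bool :=
  nth false (nth [::] [:: [:: false; false; false; false];
                          [:: false; true;  false; true ];
                          [:: false; true;  true;  false];
                          [:: false; false; true;  true ]] m) n.

(** The four cases are the four terms of the Cayley-Dickson product; each bit
[_ != 0] comes from a conjugation. *)
Definition osign (m n : nat) : bool :=
  match (m < 4)%N, (n < 4)%N with
  | true, true => qsign m n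
  | true, false => qsign (n - 4) m
  | false, true => (n != 0%N) (+) qsign (m - 4) n
  | false, false => ~~ ((n - 4 != 0)%N (+) qsign (n - 4) (m - 4))
  end.

(** This and the next two lemmas let statements about basis indices be decided by
evaluation. *)
Lemma all_below n (P : pred nat) :
  all P (iota 0 n) -> forall m, (m < n)%N -> P m.
Proof. by move=> /allP allP m lt_mn; apply: allP; rewrite mem_iota. Qed.

Lemma all_below2 n (P : nat -> nat -> bool) :
    all (fun p => all (P p) (iota 0 n)) (iota 0 n) ->
  forall p q, (p < n)%N -> (q < n)%N -> P p q.
Proof. by move=> /all_below P2 p q lt_pn; apply/all_below/P2. Qed.

Lemma all_below3 n (P : nat -> nat -> nat -> bool) :
    all (fun p => all (fun q => all (P p q) (iota 0 n)) (iota 0 n)) (iota 0 n) ->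
  forall p q r, (p < n)%N -> (q < n)%N -> (r < n)%N -> P p q r.
Proof. by move=> /all_below P3 p q r lt_pn; apply/all_below2/P3. Qed.

Lemma quatP (R : realType) (x y : quat R) :
  (forall n, (n < 4)%N -> qcoord x n = qcoord y n) -> x = y.
Proof.
by move=> eq_xy; apply/rowP => i; have := eq_xy i (ltn_ord i);
  rewrite /qcoord inord_val.
Qed.

Lemma qcoord_mk (R : realType) (a b c d : R) n :
  (n < 4)%N -> qcoord (mkquat a b c d) n = [:: a; b; c; d]`_n.
Proof. by move=> lt_n4; rewrite /qcoord mxE inordK. Qed.

Lemma qcoord_basis (R : realType) m n :
  (m < 4)%N -> (n < 4)%N -> qcoord (qbasis R m) n = (n == m)%:R.
Proof. by move=> lt_m4 lt_n4; rewrite /qcoord mxE eqxx -val_eqE /= !inordK. Qed.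

Lemma qcoordZ (R : realType) a (x : quat R) n :
  qcoord (a *: x) n = a * qcoord x n.
Proof. by rewrite /qcoord mxE. Qed.

Lemma qcoordD (R : realType) (x y : quat R) n :
  qcoord (x + y) n = qcoord x n + qcoord y n.
Proof. by rewrite /qcoord mxE. Qed.

Definition qcoordE := (qcoord_mk, qcoordZ, qcoordD, qcoord_basis).

Lemma qmul_linearl (R : realType) a (x y z : quat R) :
  qmul (a *: x + y) z = a *: qmul x z + qmul y z.
Proof.
by apply: quatP => -[|[|[|[|n]]]] // _;
  rewrite /qmul !qcoordE //=; ring.
Qed.

Lemma qmul_linearr (R : realType) a (x y z : quat R) :
  qmul z (a *: x + y) = a *: qmul z x + qmul z y.
Proof.
by apply: quatP => -[|[|[|[|n]]]] // _;
  rewrite /qmul !qcoordE //=; ring.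
Qed.

Lemma qconj_linear (R : realType) a (x y : quat R) :
  qconj (a *: x + y) = a *: qconj x + qconj y.
Proof.
by apply: quatP => -[|[|[|[|n]]]] // _; rewrite /qconj !qcoordE //=; ring.
Qed.

Lemma qmul0l (R : realType) (z : quat R) : qmul 0 z = 0.
Proof. by have := qmul_linearl (-1) 0 0 z; rewrite scaler0 addr0 scaleN1r addNr. Qed.

Lemma qmul0r (R : realType) (z : quat R) : qmul z 0 = 0.
Proof. by have := qmul_linearr (-1) 0 0 z; rewrite scaler0 addr0 scaleN1r addNr. Qed.

Lemma qconj0 (R : realType) : qconj (0 : quat R) = 0.
Proof.
have := qconj_linear (-1) (0 : quat R) 0.
by rewrite scaler0 addr0 scaleN1r addNr.
Qed.

Lemma qmulZl (R : realType) a (x z : quat R) : qmul (a *: x) z = a *: qmul x z.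
Proof. by rewrite -[a *: x]addr0 qmul_linearl qmul0l addr0. Qed.

Lemma qmulZr (R : realType) a (x z : quat R) : qmul z (a *: x) = a *: qmul z x.
Proof. by rewrite -[a *: x]addr0 qmul_linearr qmul0r addr0. Qed.

Lemma qconj_basis (R : realType) m :
  (m < 4)%N -> qconj (qbasis R m) = (-1) ^+ (m != 0%N) *: qbasis R m.
Proof.
move=> lt_m4; apply: quatP; case: m lt_m4 => [|[|[|[|m]]]] // _;
  by case=> [|[|[|[|n]]]] // _; rewrite /qconj !qcoordE //=; ring.
Qed.

Lemma qmul_basis (R : realType) m n : (m < 4)%N -> (n < 4)%N ->
  qmul (qbasis R m) (qbasis R n) = (-1) ^+ qsign m n *: qbasis R (Nat.lxor m n).
Proof.
move=> lt_m4 lt_n4; apply: quatP.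
case: m lt_m4 => [|[|[|[|m]]]] // _; case: n lt_n4 => [|[|[|[|n]]]] // _;
  by case=> [|[|[|[|l]]]] // _; rewrite /qmul !qcoordE //=; ring.
Qed.

Lemma mkoct_linear (R : realType) a (x y x' y' : quat R) :
  mkoct (a *: x + x') (a *: y + y') = a *: mkoct x y + mkoct x' y'.
Proof.
rewrite -[LHS](add_row_mx (a *: x) (a *: y)); congr (_ + _).
by rewrite /mkoct (@scale_row_mx R 1 4 4).
Qed.

Lemma oct1_linear (R : realType) a (x y : oct R) :
  oct1 (a *: x + y) = a *: oct1 x + oct1 y.
Proof. exact: (linearP (@lsubmx R 1 4 4)). Qed.

Lemma oct2_linear (R : realType) a (x y : oct R) :
  oct2 (a *: x + y) = a *: oct2 x + oct2 y.
Proof. exact: (linearP (@rsubmx R 1 4 4)). Qed.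

Lemma oct1_mk (R : realType) (x y : quat R) : oct1 (mkoct x y) = x.
Proof. exact: row_mxKl. Qed.

Lemma oct2_mk (R : realType) (x y : quat R) : oct2 (mkoct x y) = y.
Proof. exact: row_mxKr. Qed.

Lemma obasis_lo (R : realType) m :
  (m < 4)%N -> obasis R m = mkoct (qbasis R m) 0.
Proof.
move=> lt_m4; have lt_m8 : (m < 8)%N by apply: leq_trans lt_m4 _.
have -> : obasis R m = delta_mx 0 (lshift 4 (inord m : 'I_4)) :> 'rV_(4 + 4).
  by congr delta_mx; apply: val_inj; rewrite /= !inordK.
by rewrite /mkoct /qbasis delta_mx_lshift.
Qed.

Lemma obasis_hi (R : realType) m :
  (m < 4)%N -> obasis R (4 + m) = mkoct 0 (qbasis R m).
Proof.
move=> lt_m4; have lt_m8 : (4 + m < 8)%N by rewrite (ltn_add2l 4 m 4).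
have -> : obasis R (4 + m) = delta_mx 0 (rshift 4 (inord m : 'I_4)) :> 'rV_(4 + 4).
  by congr delta_mx; apply: val_inj; rewrite /= !inordK.
by rewrite /mkoct /qbasis delta_mx_rshift.
Qed.

Lemma omul_linearl (R : realType) a (x y z : oct R) :
  omul (a *: x + y) z = a *: omul x z + omul y z.
Proof.
rewrite /omul -mkoct_linear !(oct1_linear, oct2_linear).
rewrite !(qmul_linearl, qmul_linearr) scalerBr scalerDr opprD.
by congr mkoct; rewrite addrACA.
Qed.

Lemma mkoctZ (R : realType) a (x y : quat R) :
  a *: mkoct x y = mkoct (a *: x) (a *: y).
Proof. by rewrite /mkoct (@scale_row_mx R 1 4 4). Qed.

Lemma lt8_split k :
  (k < 8)%N -> (k < 4)%N \/ exists2 l, (l < 4)%N & k = (4 + l)%N.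
Proof.
move=> lt_k8; case: (ltnP k 4) => [|le4k]; [by left | right].
by exists (k - 4)%N; [rewrite ltn_subLR | rewrite subnKC].
Qed.

Lemma omul_basis (R : realType) m n : (m < 8)%N -> (n < 8)%N ->
  omul (obasis R m) (obasis R n) = (-1) ^+ osign m n *: obasis R (Nat.lxor m n).
Proof.
have xor2 := @all_below2 4 (fun k l => [&& Nat.lxor k l < 4,
  Nat.lxor k (4 + l) == 4 + Nat.lxor l k, Nat.lxor (4 + k) l == 4 + Nat.lxor k l
  & Nat.lxor (4 + k) (4 + l) == Nat.lxor l k])%N isT.
have hi k : (4 + k < 4)%N = false by rewrite ltnNge leq_addr.
have blockE := (oct1_mk, oct2_mk, qmul0l, qmul0r, qconj0, qmulZl, qmulZr,
  oppr0, addr0, add0r, subr0, sub0r, mkoctZ, scaler0).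
move=> /lt8_split[lt_m4|[k lt_k4 ->]] /lt8_split[lt_n4|[l lt_l4 ->]].
- have /and4P[lt_x _ _ _] := xor2 _ _ lt_m4 lt_n4.
  rewrite !obasis_lo // /omul !blockE /osign lt_m4 lt_n4.
  by rewrite qmul_basis.
- have /and4P[_ /eqP-> _ _] := xor2 _ _ lt_m4 lt_l4.
  have /and4P[lt_x _ _ _] := xor2 _ _ lt_l4 lt_m4.
  rewrite (obasis_lo R lt_m4) !obasis_hi // /omul !blockE /osign lt_m4.
  by rewrite hi addKn qmul_basis.
- have /and4P[lt_x _ /eqP-> _] := xor2 _ _ lt_k4 lt_n4.
  rewrite (obasis_lo R lt_n4) !obasis_hi // /omul !blockE /osign lt_n4.
  rewrite hi addKn qconj_basis //.
  by rewrite qmulZr qmul_basis // scalerA -signr_addb.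
- have /and4P[_ _ _ /eqP->] := xor2 _ _ lt_k4 lt_l4.
  have /and4P[lt_x _ _ _] := xor2 _ _ lt_l4 lt_k4.
  rewrite !obasis_hi // obasis_lo // /omul !blockE /osign !hi !addKn qconj_basis //.
  by rewrite qmulZl qmul_basis // scalerA -signr_addb signrN scaleNr.
Qed.

(** * Signed translations of the standard basis *)

(** Besides linearity: [J] permutes the basis by a translation of F_2^3, up to
signs. *)
Definition monomial (R : realType) (J : oct R -> oct R) (c : nat)
    (sg : nat -> bool) : Prop :=
  linear J /\
  (forall q, (q < 8)%N ->
     J (obasis R q) = (-1) ^+ sg q *: obasis R (Nat.lxor q c)).

Definition entry (c : nat) (sg : nat -> bool) (p q : nat) : int :=
  if Nat.lxor p q == c then (-1) ^+ sg q else 0.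

Lemma lxor_lt8 m n : (m < 8)%N -> (n < 8)%N -> (Nat.lxor m n < 8)%N.
Proof. exact: (@all_below2 8 (fun m n => Nat.lxor m n < 8)%N isT). Qed.

Lemma lxorC8 m n : (m < 8)%N -> (n < 8)%N -> Nat.lxor m n = Nat.lxor n m.
Proof.
have check := @all_below2 8 (fun m n => Nat.lxor m n == Nat.lxor n m) isT.
by move=> ltm ltn; apply/eqP/check.
Qed.

Lemma lxorA8 l m n : (l < 8)%N -> (m < 8)%N -> (n < 8)%N ->
  Nat.lxor (Nat.lxor l m) n = Nat.lxor l (Nat.lxor n m).
Proof.
have check := @all_below3 8 (fun l m n =>
  Nat.lxor (Nat.lxor l m) n == Nat.lxor l (Nat.lxor n m)) isT.
by move=> ltl ltm ltn; apply/eqP/check.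
Qed.

Lemma lxor_eqE p q c : (p < 8)%N -> (q < 8)%N -> (c < 8)%N ->
  (p == Nat.lxor q c) = (Nat.lxor p q == c).
Proof.
have check := @all_below3 8 (fun p q c =>
  (p == Nat.lxor q c) == (Nat.lxor p q == c)) isT.
by move=> ltp ltq ltc; apply: (eqP (check p q c ltp ltq ltc)).
Qed.

Lemma linear_basis (R : realType) (J : oct R -> oct R) x :
    linear J ->
  J x = \sum_(q < 8) x 0 q *: J (obasis R q).
Proof.
move=> linJ.
pose f : {linear oct R -> oct R} :=
  HB.pack J (GRing.isLinear.Build R (oct R) (oct R) *:%R J linJ).
rewrite -[J x]/(f x) {1}(row_sum_delta x) linear_sum; apply: eq_bigr => q _.
by rewrite linearZ /obasis inord_val.
Qed.

Lemma obasisE (R : realType) m (p : 'I_8) :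
  (m < 8)%N -> obasis R m 0 p = (nat_of_ord p == m)%:R.
Proof. by move=> lt_m8; rewrite mxE eqxx -val_eqE /= inordK. Qed.

Lemma monomial_form2 (R : realType) (J : oct R -> oct R) c sg x y :
  (c < 8)%N -> monomial J c sg -> inner x (J y) = form2 (entry c sg) x y.
Proof.
move=> lt_c8 [linJ basisJ]; rewrite (linear_basis y linJ) /inner /form2.
apply: eq_bigr => p _; rewrite summxE big_distrr; apply: eq_bigr => q _ /=.
rewrite basisJ // scalerA mxE obasisE ?lxor_lt8 // -!mulrA /entry; congr (_ * (_ * _)).
by rewrite lxor_eqE //; case: eqP => _; rewrite ?mulr0 // mulr1 rmorph_sign.
Qed.

Lemma linear_scale (R : realType) (J : oct R -> oct R) k x :
    linear J ->
  J (k *: x) = k *: J x.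
Proof.
move=> linJ; have J0 : J 0 = 0.
  by have := linJ (-1) 0 0; rewrite scaler0 addr0 scaleN1r addNr.
by rewrite -[k *: x]addr0 linJ J0 addr0.
Qed.

Lemma monomial_comp (R : realType) (J K : oct R -> oct R) c d s t :
    (c < 8)%N -> (d < 8)%N -> monomial J c s -> monomial K d t ->
  monomial (J \o K) (Nat.lxor c d) (fun q => t q (+) s (Nat.lxor q d)).
Proof.
move=> lt_c8 lt_d8 [linJ basisJ] [linK basisK]; split=> [a x y|q lt_q8] /=.
  by rewrite linK linJ.
by rewrite basisK // linear_scale // basisJ ?lxor_lt8 // scalerA -signr_addb lxorA8.
Qed.

Lemma monomial_oct_right (R : realType) a : (a < 8)%N ->
  monomial (oct_right (obasis R a)) a (osign ^~ a).
Proof.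
move=> lt_a8; split=> [k x y|q lt_q8]; first exact: omul_linearl.
exact: omul_basis.
Qed.

Lemma lxor_lt4 k l : (k < 4)%N -> (l < 4)%N ->
  [/\ (Nat.lxor k l < 4)%N, Nat.lxor k l = Nat.lxor l k
    & Nat.lxor (4 + k) l = (4 + Nat.lxor k l)%N].
Proof.
have check := @all_below2 4 (fun k l => [&& Nat.lxor k l < 4,
  Nat.lxor k l == Nat.lxor l k & Nat.lxor (4 + k) l == 4 + Nat.lxor k l])%N isT.
by move=> ltk ltl; have /and3P[? /eqP? /eqP?] := check k l ltk ltl.
Qed.

Lemma monomial_quat_left (R : realType) u : (u < 4)%N ->
  monomial (quat_left (qbasis R u)) u (fun q => qsign u (q %% 4)).
Proof.
move=> lt_u4; split=> [k x y|q /lt8_split[lt_q4|[l lt_l4 ->]]].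
- by rewrite /quat_left -mkoct_linear !(oct1_linear, oct2_linear, qmul_linearr).
- have [lt_x xC _] := lxor_lt4 lt_q4 lt_u4.
  rewrite !obasis_lo // mkoctZ /quat_left oct1_mk oct2_mk qmul_basis // qmul0r.
  by rewrite scaler0 modn_small // xC.
have [lt_x xC ->] := lxor_lt4 lt_l4 lt_u4.
rewrite !obasis_hi // mkoctZ /quat_left oct1_mk oct2_mk qmul_basis // qmul0r.
by rewrite scaler0 modnDl modn_small // xC.
Qed.

Lemma monomial_quat_right (R : realType) u : (u < 4)%N ->
  monomial (quat_right (qbasis R u)) u (fun q => qsign (q %% 4) u).
Proof.
move=> lt_u4; split=> [k x y|q /lt8_split[lt_q4|[l lt_l4 ->]]].
- by rewrite /quat_right -mkoct_linear !(oct1_linear, oct2_linear, qmul_linearl).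
- have [lt_x xC _] := lxor_lt4 lt_q4 lt_u4.
  rewrite !obasis_lo // mkoctZ /quat_right oct1_mk oct2_mk qmul_basis // qmul0l.
  by rewrite scaler0 modn_small.
have [lt_x xC ->] := lxor_lt4 lt_l4 lt_u4.
rewrite !obasis_hi // mkoctZ /quat_right oct1_mk oct2_mk qmul_basis // qmul0l.
by rewrite scaler0 modnDl modn_small.
Qed.

(** The translation by [c] is an involution, so skewness only says that both
elements of each of its orbits carry opposite signs. *)
Lemma entry_skew c sg (p q : 'I_8) : (c < 8)%N ->
    (forall m, (m < 8)%N -> sg (Nat.lxor m c) = ~~ sg m) ->
  entry c sg q p = - entry c sg p q.
Proof.
move=> lt_c8 sgN; rewrite /entry (lxorC8 (ltn_ord q)) //.
have [/eqP|] := eqVneq (Nat.lxor p q) c; last by rewrite oppr0.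
by rewrite -lxor_eqE // => /eqP->; rewrite sgN // signrN.
Qed.

(** * The relation between the squares *)

Definition right_sq (R : realType) a : Defs.form R 4 :=
  wedge_sq (kahler (oct_right (obasis R a))).
Definition right2_sq (R : realType) a b : Defs.form R 4 :=
  wedge_sq (kahler (oct_right (obasis R a) \o oct_right (obasis R b))).

Definition right_sign a q := osign q a.
Definition right2_sign a b q := osign q b (+) osign (Nat.lxor q b) a.
Definition right_coef a := sq_coef (entry a (right_sign a)).
Definition right2_coef a b := sq_coef (entry (Nat.lxor a b) (right2_sign a b)).

Lemma right_signN a q : (0 < a < 8)%N -> (q < 8)%N ->
  right_sign a (Nat.lxor q a) = ~~ right_sign a q.
Proof.
have check := @all_below2 8 (fun a q => (0 < a)%N ==>
  (right_sign a (Nat.lxor q a) == ~~ right_sign a q)) isT.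
move=> /andP[a_gt0 lt_a8] lt_q8.
exact: (eqP (implyP (check a q lt_a8 lt_q8) a_gt0)).
Qed.

Lemma right2_signN a b q : (0 < a < 8)%N -> (0 < b < 8)%N -> a != b -> (q < 8)%N ->
  right2_sign a b (Nat.lxor q (Nat.lxor a b)) = ~~ right2_sign a b q.
Proof.
move=> /andP[a_gt0 lt_a8] /andP[b_gt0 lt_b8] neq_ab lt_q8.
have check := @all_below3 8 (fun a b q => [&& 0 < a, 0 < b & a != b]%N ==>
  (right2_sign a b (Nat.lxor q (Nat.lxor a b)) == ~~ right2_sign a b q)) isT.
by apply: (eqP (implyP (check a b q lt_a8 lt_b8 lt_q8) _)); rewrite a_gt0 b_gt0.
Qed.

Lemma right_sqE (R : realType) a (v : 'I_4 -> oct R) : (0 < a < 8)%N ->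
  right_sq a v = 2 * form4 (right_coef a) v.
Proof.
move=> a_range; have /andP[_ lt_a8] := a_range.
apply: wedge_sq_form2 => [x y|p q]; first exact/monomial_form2/monomial_oct_right.
by apply: entry_skew => // m lt_m8; apply: right_signN.
Qed.

Lemma right2_sqE (R : realType) a b (v : 'I_4 -> oct R) :
    (0 < a < 8)%N -> (0 < b < 8)%N -> a != b ->
  right2_sq a b v = 2 * form4 (right2_coef a b) v.
Proof.
move=> a_range b_range neq_ab.
have /andP[_ lt_a8] := a_range; have /andP[_ lt_b8] := b_range.
apply: wedge_sq_form2 => [x y|p q].
  apply: monomial_form2; first exact: lxor_lt8.
  exact: (monomial_comp lt_a8 lt_b8 (monomial_oct_right R lt_a8)
                                    (monomial_oct_right R lt_b8)).
by apply: entry_skew; [exact: lxor_lt8 | move=> m; apply: right2_signN].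
Qed.

(** Each product in [sq_coef] is nonzero only if the four indices fall into two
pairs with the same difference [c]; the four indices then add up to 0 in F_2^3.
This leaves 8^3 instead of 8^4 coefficients to compare. *)
Lemma sq_coef_entry0 c sg (p q r s : 'I_8) :
  nat_of_ord s != Nat.lxor (Nat.lxor p q) r -> sq_coef (entry c sg) p q r s = 0.
Proof.
have check := @all_below3 8 (fun p q r => all (fun s =>
  [|| Nat.lxor p q == Nat.lxor r s, Nat.lxor p r == Nat.lxor q s
    | Nat.lxor p s == Nat.lxor q r] ==> (s == Nat.lxor (Nat.lxor p q) r))
  (iota 0 8)) isT.
have {check} := all_below (check p q r (ltn_ord p) (ltn_ord q) (ltn_ord r)) (ltn_ord s).
move=> /implyP pairing neq_s; have {pairing neq_s} := contraNN pairing neq_s.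
rewrite !negb_or /sq_coef /entry => /and3P[neq1 neq2 neq3].
have cross0 m n l k : Nat.lxor m n != Nat.lxor l k ->
    (if Nat.lxor m n == c then (-1) ^+ sg n else 0) *
    (if Nat.lxor l k == c then (-1) ^+ sg k else 0) = 0 :> int.
  move=> neq; case: eqP => [eq1|_]; last by rewrite mul0r.
  by case: eqP => [eq2|_]; [rewrite eq1 eq2 eqxx in neq | rewrite mulr0].
by rewrite !cross0 // subr0 addr0.
Qed.

Definition right_total p q r s : int :=
  foldr (fun c z => right_coef c p q r s + z) 0 (iota 1 7).

Lemma right2_coefE a b (p q r s : 'I_8) :
    (0 < a < 8)%N -> (0 < b < 8)%N -> a != b ->
  3 * right2_coef a b p q r s =
    3 * right_coef a p q r s + 3 * right_coef b p q r s - right_total p q r s.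
Proof.
have [-> | neq_s] := eqVneq (nat_of_ord s) (Nat.lxor (Nat.lxor p q) r); last first.
  by rewrite /right_total /right2_coef /right_coef /= !sq_coef_entry0.
have check : all (fun p => all (fun q => all (fun r =>
    let s := Nat.lxor (Nat.lxor p q) r in let S := right_total p q r s in
    all (fun a => all (fun b => (a != b) ==>
      (3 * right2_coef a b p q r s ==
       3 * right_coef a p q r s + 3 * right_coef b p q r s - S))
    (iota 1 7)) (iota 1 7)) (iota 0 8)) (iota 0 8)) (iota 0 8).
  by vm_compute.
move=> a_range b_range neq_ab.
have /allP/(_ a) := all_below3 check (ltn_ord p) (ltn_ord q) (ltn_ord r).
rewrite mem_iota => /(_ a_range)/allP/(_ b); rewrite mem_iota => /(_ b_range).
by rewrite neq_ab => /eqP.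
Qed.

(** The relation Q_ab = Q_a + Q_b - S/3, with denominators cleared. *)
Lemma right2_sq_key (R : realType) a b (v : 'I_4 -> oct R) :
    (0 < a < 8)%N -> (0 < b < 8)%N -> a != b ->
  3 * right2_sq a b v =
    3 * right_sq a v + 3 * right_sq b v - \sum_(c <- iota 1 7) right_sq c v.
Proof.
move=> a_range b_range neq_ab.
have -> : \sum_(c <- iota 1 7) right_sq c v = 2 * form4 right_total v.
  rewrite -(form4_sum _ right_coef) mulr_sumr; apply: eq_big_seq => c.
  by rewrite mem_iota => c_range; apply: right_sqE.
rewrite right2_sqE // !right_sqE //.
have key : 3 * form4 (right2_coef a b) v =
    3 * form4 (right_coef a) v + 3 * form4 (right_coef b) v - form4 right_total v.
  rewrite -[3]/(3%:~R) -[- form4 _ _]mulN1r -[-1]/((-1)%:~R) -!form4Z -!form4D.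
  by apply: form4_ext => p q r s; rewrite right2_coefE // mulN1r.
by rewrite mulrCA key; ring.
Qed.

(** * Quaternion and octonion units *)

Lemma mkquat_basis (R : realType) :
  [/\ q1 R = qbasis R 0, qi R = qbasis R 1, qj R = qbasis R 2 & qk R = qbasis R 3].
Proof.
by split; apply: quatP => -[|[|[|[|n]]]] // _; rewrite qcoord_mk ?qcoord_basis.
Qed.

Lemma imag_unitsE (R : realType) : imag_units R = map (obasis R) (iota 1 7).
Proof.
have [q1E qiE qjE qkE] := mkquat_basis R.
have oiE : oi R = obasis R 1 by rewrite obasis_lo // -qiE.
have ojE : oj R = obasis R 2 by rewrite obasis_lo // -qjE.
have okE : ok R = obasis R 3 by rewrite obasis_lo // -qkE.
have oeE : oe R = obasis R 4 by rewrite (obasis_hi R (m := 0)) // -q1E.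
rewrite /imag_units /of_ /og /oh oiE ojE okE oeE !omul_basis //=.
by rewrite !expr0 !scale1r.
Qed.

(** On the first copy of H the operator R_a o R_b is right multiplication by ba,
and on the second one by the conjugate of ab, which is again ba because ab is
imaginary.  So R_a o R_b is right multiplication by ba on H^2, and ba is, up to
sign, the third unit. *)
Lemma quat_right_sq (R : realType) a b (v : 'I_4 -> oct R) :
    (0 < a < 4)%N -> (0 < b < 4)%N -> a != b ->
  wedge_sq (kahler (quat_right (qbasis R (Nat.lxor a b)))) v = right2_sq a b v.
Proof.
move=> /andP[a_gt0 lt_a4] /andP[b_gt0 lt_b4] neq_ab.
have le48 m : (m < 4 -> m < 8)%N by move=> ?; apply: ltn_trans (_ : 4 < 8)%N.
have [lt_x4 _ _] := lxor_lt4 lt_a4 lt_b4.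
have check := @all_below3 8 (fun a b q =>
  [&& 0 < a < 4, 0 < b < 4 & a != b]%N ==>
  (qsign (q %% 4) (Nat.lxor a b) == qsign b a (+) right2_sign a b q)) isT.
have signE q : (q < 8)%N ->
    qsign (q %% 4) (Nat.lxor a b) = qsign b a (+) right2_sign a b q.
  move=> lt_q8; apply: (eqP (implyP (check a b q (le48 a lt_a4) (le48 b lt_b4) lt_q8) _)).
  by rewrite a_gt0 lt_a4 b_gt0 lt_b4.
have entryE (p q : 'I_8) :
    entry (Nat.lxor a b) (fun q => qsign (q %% 4) (Nat.lxor a b)) p q =
    (-1) ^+ qsign b a * entry (Nat.lxor a b) (right2_sign a b) p q.
  by rewrite /entry; case: eqP; rewrite ?mulr0 // signE // signr_addb.
rewrite right2_sqE ?a_gt0 ?b_gt0 ?le48 //.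
rewrite (wedge_sq_form2
  (W := entry (Nat.lxor a b) (fun q => qsign (q %% 4) (Nat.lxor a b)))).
- congr (_ * _); apply: form4_ext => p q r s.
  have sign2 : (-1) ^+ qsign b a * (-1) ^+ qsign b a = 1 :> int.
    by rewrite -signr_addb addbb.
  transitivity ((-1) ^+ qsign b a * (-1) ^+ qsign b a * right2_coef a b p q r s);
    last by rewrite sign2 mul1r.
  rewrite /right2_coef /sq_coef !entryE.
  by move: (entry _ _) ((-1) ^+ _) => W e; ring.
- by move=> x y; apply: monomial_form2; [apply: le48 | apply: monomial_quat_right].
move=> p q; rewrite !entryE -mulrN; congr (_ * _).
apply: entry_skew => [|m]; first exact: le48.
by apply: right2_signN; rewrite ?a_gt0 ?b_gt0 ?le48.
Qed.

(** * The sum over five complex structures *)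

Lemma sum_ord_pairs (V : nmodType) n (f : 'I_n -> V) :
  \sum_(a < n) \sum_(b < n | (a < b)%N) (f a + f b) = (\sum_(a < n) f a) *+ n.-1.
Proof.
under eq_bigr => a _ do rewrite big_split.
rewrite big_split /= [X in _ + X](exchange_big_dep xpredT) //= -big_split -sumrMnl.
apply: eq_bigr => a _ /=.
have -> : f a *+ n.-1 = \sum_(b < n | b != a) f a.
  by rewrite sumr_const (eq_card (B := predC1 a)) // cardC1 card_ord.
rewrite [RHS](bigID (fun b : 'I_n => (a < b)%N)) /=.
by congr (_ + _); apply: eq_bigl => b; rewrite -val_eqE neq_ltn; case: ltngtP.
Qed.

Lemma oct_index (R : realType) (u : 5.-tuple (oct R)) :
    uniq u -> {subset u <= imag_units R} ->
  exists m : 5.-tuple nat,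
    [/\ u = map_tuple (obasis R) m, uniq m & {subset m <= iota 1 7}].
Proof.
move=> uniq_u sub_u.
(* Index 0 is the real unit, hence the successor. *)
pose ind x := (index x (imag_units R)).+1.
have u_ind : u = map_tuple (obasis R) (map_tuple ind u).
  apply: val_inj; rewrite /= -map_comp -[LHS]map_id; apply/eq_in_map => x /sub_u u_x.
  rewrite /= /ind -[LHS](nth_index 0 u_x) imag_unitsE (nth_map 0%N) -?imag_unitsE.
    by rewrite nth_iota // -[7%N]/(size (imag_units R)) index_mem.
  by rewrite size_iota -[7%N]/(size (imag_units R)) index_mem.
exists (map_tuple ind u); split=> //.
  by move: uniq_u; rewrite {1}u_ind => /map_uniq.
move=> _ /mapP[x /sub_u u_x ->]; rewrite mem_iota /= /ind ltnS.
by rewrite -[7%N]/(size (imag_units R)) index_mem.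
Qed.

(** Each of the five selected units occurs in four of the ten pairs, so the
relation gives 4 (S - Q_a - Q_b) - 10 S/3 for the sum, where a and b are the
other two units; the relation for this pair turns it into
- 2 (Q_a + Q_b + Q_ab). *)
Lemma zeta_sq_sumE (R : realType) (m : 5.-tuple nat) :
    uniq m -> {subset m <= iota 1 7} ->
  exists a b : nat, [/\ (0 < a < 8)%N, (0 < b < 8)%N, a != b &
    forall v, - (2^-1 * zeta_sq_sum (map_tuple (obasis R) m) v) =
      right_sq a v + right_sq b v + right2_sq a b v].
Proof.
move=> uniq_m sub_m.
pose d := [seq c <- iota 1 7 | c \notin m].
have perm_md : perm_eq (m ++ d) (iota 1 7).
  apply: uniq_perm; rewrite ?iota_uniq //.
    rewrite cat_uniq uniq_m filter_uniq ?iota_uniq // andbT.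
    by apply/hasPn => c; rewrite mem_filter => /andP[].
  move=> c; rewrite mem_cat mem_filter; case: (boolP (c \in m)) => [/sub_m->|] //.
have size_d : size d = 2%N.
  by have := perm_size perm_md; rewrite size_cat size_tuple size_iota => -[].
have d_range c : c \in d -> (0 < c < 8)%N.
  by rewrite mem_filter mem_iota => /andP[].
have uniq_d : uniq d by rewrite filter_uniq ?iota_uniq.
case: d size_d d_range uniq_d perm_md => [|a [|b []]] // _ d_range uniq_d perm_md.
have a_range : (0 < a < 8)%N by rewrite d_range ?mem_head.
have b_range : (0 < b < 8)%N by rewrite d_range // !inE eqxx orbT.
have neq_ab : a != b by move: uniq_d; rewrite /= inE andbT.
exists a, b; split=> // v.
pose Q c := right_sq c v; pose S := \sum_(c <- iota 1 7) Q c.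
have S_eq : S = \sum_(i < 5) Q (tnth m i) + Q a + Q b.
  by rewrite /S -(perm_big _ perm_md) big_cat big_tuple /= big_cons big_seq1 addrA.
have m_range i : (0 < tnth m i < 8)%N.
  by have := sub_m _ (mem_tnth i m); rewrite mem_iota.
have three_sum : 3 * zeta_sq_sum (map_tuple (obasis R) m) v =
    12 * (\sum_(i < 5) Q (tnth m i)) - 10 * S.
  (* Splitting -S evenly turns the relation into a sum of two terms, one for each
     element of the pair. *)
  pose f i := 3 * Q (tnth m i) - 2^-1 * S.
  transitivity (\sum_(i < 5) \sum_(j < 5 | (i < j)%N) (f i + f j)).
    rewrite /zeta_sq_sum big_distrr; apply: eq_bigr => i _; rewrite big_distrr.
    apply: eq_bigr => j lt_ij; rewrite /zeta !tnth_map.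
    have neq_ij : tnth m i != tnth m j.
      by rewrite (inj_eq (elimT (tuple_uniqP m) uniq_m)) neq_ltn lt_ij.
    by rewrite /= right2_sq_key // -/(Q _) -/(Q _) -/S /f; field.
  by rewrite (sum_ord_pairs f) -mulr_natl sumrB -mulr_sumr sumr_const
    card_ord -[_ *+ 5]mulr_natl /=; field.
have key := right2_sq_key v a_range b_range neq_ab.
have three_neq0 : (3 : R) != 0 by rewrite pnatr_eq0.
apply: (mulfI three_neq0); rewrite !mulrDr key -/(Q a) -/(Q b) -/S.
by rewrite mulrN mulrCA three_sum S_eq; field.
Qed.

(** * Change of coordinates *)

Lemma wedge_sq_pullback (R : realType) (a b : Defs.form R 2) (A : 'M[R]_8) v :
  (forall w, a w = pullback A b w) -> wedge_sq a v = pullback A (wedge_sq b) v.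
Proof.
move=> ab; rewrite /pullback /wedge_sq /wedge; congr (_ * _).
by apply: eq_bigr => s _; rewrite !ab.
Qed.

Lemma inner_signed_perm (R : realType) (A : 'M[R]_8) x y :
  signed_perm_mx A -> inner (x *m A) (y *m A) = inner x y.
Proof.
move=> [s [eps Aeps]].
have innerE (z t : oct R) : inner z t = (z *m t^T) 0 0.
  by rewrite mxE; apply: eq_bigr => n _; rewrite mxE.
have AAT : A *m A^T = 1%:M.
  have AE i l : A i l = (-1) ^+ eps i * (l == s i)%:R.
    by have /rowP/(_ l) := Aeps i; rewrite -rowE !mxE eqxx.
  apply/matrixP => i j; rewrite !mxE (bigD1 (s i)) //= big1 => [|l neq_l].
    rewrite mxE !AE eqxx (inj_eq perm_inj) addr0 mulr1.
    case: eqP => [->|_]; last by rewrite !mulr0.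
    by rewrite mulr1 -signr_addb addbb.
  by rewrite AE (negPf neq_l) mulr0 mul0r.
by rewrite !innerE trmx_mul -mulmxA (mulmxA A) AAT mul1mx.
Qed.

Lemma linear_basis_eq (R : realType) (f g : oct R -> oct R) :
    linear f ->
    linear g ->
    (forall q, (q < 8)%N -> f (obasis R q) = g (obasis R q)) ->
  f =1 g.
Proof.
move=> linf ling fg x; rewrite (linear_basis x linf) (linear_basis x ling).
by apply: eq_bigr => q _; rewrite fg.
Qed.

(** The basis index [n] has bits n0, n1, n2, and [frame a b c n] is the index and
sign bit of R_a^n0 R_b^n1 applied to the basis vector [c] if n2 = 1, and to the
unit 1 otherwise.  This makes R_a, R_b, R_a o R_b act on the frame as L_i, L_j,
L_k act on the standard basis; [frame_fst] is the part without R_a. *)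
Definition frame_fst (b c n : nat) : nat * bool :=
  let q := if (4 <= n)%N then c else 0%N in
  if odd n./2 then (Nat.lxor q b, osign q b) else (q, false).

Definition frame (a b c n : nat) : nat * bool :=
  let: (q, sg) := frame_fst b c n in
  if odd n then (Nat.lxor q a, sg (+) osign q a) else (q, sg).

Definition frame_mx (R : realType) a b c : 'M[R]_8 :=
  \matrix_(n < 8) ((-1) ^+ (frame a b c n).2 *: obasis R (frame a b c n).1).

Lemma frame_mxE (R : realType) a b c n : (n < 8)%N ->
  obasis R n *m frame_mx R a b c =
    (-1) ^+ (frame a b c n).2 *: obasis R (frame a b c n).1.
Proof. by move=> lt_n8; rewrite -rowE rowK inordK. Qed.

(** What the change of coordinates needs from [c], in a form that evaluation
decides.  [act u d sg] is the intertwining of left multiplication by the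
quaternion unit [u] with the translation by [d] with signs [sg], at the basis
vector [n]. *)
Definition frame_spec a b c : bool :=
  [&& uniq [seq (frame a b c n).1 | n <- iota 0 8],
      all (fun n => (frame a b c n).1 < 8)%N (iota 0 8)
    & all (fun n =>
        let act u d sg := (frame a b c (Nat.lxor n u) ==
          (Nat.lxor (frame a b c n).1 d,
           qsign u (n %% 4) (+) (frame a b c n).2 (+) sg (frame a b c n).1)) in
        [&& act 1 a (right_sign a), act 2 b (right_sign b)
          & act 3 (Nat.lxor a b) (right2_sign a b)]%N)
      (iota 0 8)].

(** Any [c] outside of the subgroup of F_2^3 generated by [a] and [b] works. *)
Lemma frame_exists a b : (0 < a < 8)%N -> (0 < b < 8)%N -> a != b ->
  exists c, frame_spec a b c.
Proof.
move=> /andP[a_gt0 lt_a8] /andP[b_gt0 lt_b8] neq_ab.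
have check := @all_below2 8 (fun a b => [&& 0 < a, 0 < b & a != b]%N ==>
  has (frame_spec a b) (iota 0 8)) isT.
have /implyP := check a b lt_a8 lt_b8.
by rewrite a_gt0 b_gt0 => /(_ neq_ab)/hasP[c _ spec_c]; exists c.
Qed.

Lemma frame_signed_perm (R : realType) a b c :
  frame_spec a b c -> signed_perm_mx (frame_mx R a b c).
Proof.
move=> /and3P[/mkseq_uniqP f_inj_on /all_below lt_f8 _].
pose f (n : 'I_8) : 'I_8 := Ordinal (lt_f8 n (ltn_ord n)).
have f_inj : injective f.
  by move=> i j [eq_f]; apply: val_inj; apply: f_inj_on eq_f; apply: ltn_ord.
exists (perm f_inj), (fun n => (frame a b c n).2) => n.
rewrite permE -rowE rowK /obasis; congr (_ *: delta_mx 0 _).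
by apply: val_inj; rewrite /= inordK ?lt_f8.
Qed.

(** An isometry [A] with (L x) A = J (x A) pulls the Kaehler form of J back to
that of L, and the hypothesis on [frame] is this intertwining relation on the
basis. *)
Lemma frame_kahler (R : realType) a b c u d sg (J : oct R -> oct R) (w : 'I_2 -> oct R) :
    frame_spec a b c -> (u < 4)%N -> (d < 8)%N -> monomial J d sg ->
    (forall n, (n < 8)%N -> frame a b c (Nat.lxor n u) =
      (Nat.lxor (frame a b c n).1 d,
       qsign u (n %% 4) (+) (frame a b c n).2 (+) sg (frame a b c n).1)) ->
  kahler (quat_left (qbasis R u)) w = pullback (frame_mx R a b c) (kahler J) w.
Proof.
move=> spec_c lt_u4 lt_d8 [linJ basisJ] act.
have /and3P[_ /all_below lt_f8 _] := spec_c.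
have [linL basisL] := monomial_quat_left R lt_u4.
have twine x : quat_left (qbasis R u) x *m frame_mx R a b c = J (x *m frame_mx R a b c).
  move: x; apply: linear_basis_eq => [k x y|k x y|q lt_q8].
  - by rewrite linL mulmxDl scalemxAl.
  - by rewrite mulmxDl -scalemxAl linJ.
  rewrite basisL // -scalemxAl !frame_mxE ?lxor_lt8 // ?(ltn_trans lt_u4) //.
  rewrite act // (linear_scale _ _ linJ) basisJ ?lt_f8 // !scalerA -!signr_addb.
  by rewrite -!addbA addKb.
rewrite /pullback /kahler -twine inner_signed_perm //.
exact: frame_signed_perm spec_c.
Qed.

Theorem theorem1p1 (R : realType) :
  (forall v : 'I_4 -> oct R,
     Omega_R v =
       wedge_sq (phi (oi R)) v + wedge_sq (phi (oj R)) v
       + wedge_sq (phi (ok R)) v - wedge_sq (phi (oe R)) v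
       - wedge_sq (phi (of_ R)) v - wedge_sq (phi (og R)) v
       - wedge_sq (phi (oh R)) v) /\
  (forall u : 5.-tuple (oct R),
     uniq u -> {subset u <= imag_units R} ->
     exists A : 'M[R]_8,
       signed_perm_mx A /\
       forall v : 'I_4 -> oct R,
         Omega_L v = pullback A (fun w => - (2^-1 * zeta_sq_sum u w)) v).
Proof.
have [_ qiE qjE qkE] := mkquat_basis R.
split=> [v | u uniq_u sub_u].
  have [-> -> -> -> -> -> ->] := imag_unitsE R.
  rewrite /Omega_R qiE qjE qkE.
  have sq a b c : (0 < a < 4)%N -> (0 < b < 4)%N -> a != b -> Nat.lxor a b = c ->
      3 * wedge_sq (kahler (quat_right (qbasis R c))) v =
      3 * right_sq a v + 3 * right_sq b v - \sum_(n <- iota 1 7) right_sq n v.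
    move=> a_range b_range neq_ab <-; rewrite quat_right_sq //.
    have wide n : (0 < n < 4 -> 0 < n < 8)%N.
      by move=> /andP[-> /leq_trans->].
    by rewrite right2_sq_key ?wide.
  have three_neq0 : (3 : R) != 0 by rewrite pnatr_eq0.
  apply: (mulfI three_neq0); rewrite !(mulrDr 3 _ (wedge_sq (kahler _) v)).
  rewrite (sq 2 3 1)%N // (sq 3 1 2)%N // (sq 1 2 3)%N //.
  have phiE a : wedge_sq (phi (obasis R a)) v = right_sq a v by [].
  rewrite !phiE !big_cons big_nil.
  move: (right_sq 1 v) (right_sq 2 v) (right_sq 3 v) (right_sq 4 v).
  move: (right_sq 5 v) (right_sq 6 v) (right_sq 7 v) => *; ring.
have [m [-> uniq_m sub_m]] := oct_index uniq_u sub_u.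
have [a [b [a_range b_range neq_ab five]]] := zeta_sq_sumE R uniq_m sub_m.
have [c spec_c] := frame_exists a_range b_range neq_ab.
exists (frame_mx R a b c); split; first exact: frame_signed_perm spec_c.
move=> v; rewrite /pullback five /Omega_L qiE qjE qkE.
have /andP[_ lt_a8] := a_range; have /andP[_ lt_b8] := b_range.
have /and3P[_ _ /all_below act] := spec_c.
congr (_ + _ + _); apply: wedge_sq_pullback => w.
- apply: frame_kahler spec_c _ _ (monomial_oct_right R lt_a8) _ => // n lt_n8.
  by have /and3P[/eqP] := act n lt_n8.
- apply: frame_kahler spec_c _ _ (monomial_oct_right R lt_b8) _ => // n lt_n8.
  by have /and3P[_ /eqP] := act n lt_n8.
have monomial_ab := monomial_comp lt_a8 lt_b8 (monomial_oct_right R lt_a8)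
  (monomial_oct_right R lt_b8).
apply: frame_kahler spec_c _ _ monomial_ab _ => // [|n lt_n8].
  exact: lxor_lt8.
by have /and3P[_ _ /eqP] := act n lt_n8.
Qed.
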